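(* Let $d\ge 1$ and let $\eta$ be an $\mathbb{N}$-valued random variable with $\mathbf{P}[\eta\ge1]>0$. Suppose that there exists $\beta<d$ such that \[ \mathbf{P}[\eta\ge n]\ge\frac{1}{(\log n)^\beta} \] for all $n$ large enough. Then $p_u(\mathbb{Z}^d,\eta)=0$.
   Context: Here $\mathbb{N}=\{0,1,2,\dots\}$, and $\mathbb{Z}^d$ denotes the graph with vertex set $\mathbb{Z}^d$ and edges between points at $\ell^1$-distance $1$, with root $\mathbf{0}$ the origin. Frog model $\mathrm{FM}(\mathcal{G},p,\eta)$. Let $\mathcal{G}$ be an infinite connected undirected graph all of whose sites (vertices) have finite degree, with a fixed site $\mathbf{0}$ called the root; let $p\in[0,1]$ and let $\eta$ be a random variable with values in $\mathbb{N}$. Let $\{\eta(x)\}_{x}$, $\{(S^x_n(i))_{n\in\mathbb{N}}\}_{x,\,i\ge1}$, $\{\Xi^x_p(i)\}_{x,\,i\ge 1}$ be independent families of independent random variables, where $\eta(x)$ has the law of $\eta$, $(S^x_n(i))_n$ is a discrete-time simple random walk on $\mathcal{G}$ started from $x$, and $\mathbf{P}[\Xi^x_p(i)=k]=(1-p)p^{k-1}$, $k=1,2,\dots$ (for $p=1$, $\Xi^x_p(i)=\infty$, no death). Site $x$ initially contains $\eta(x)$ particles; at time $0$ all particles are sleeping except those at the root, which are active. If the particles of site $x$ are activated at time $T(x)$, the $i$-th of them ($1\le i\le\eta(x)$) is active and located at $S^x_n(i)$ at time $T(x)+n$ for $0\le n<\Xi^x_p(i)$, and then disappears. When an active particle visits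 a site, all sleeping particles there become active. Formally, $t(x,y)=\min_{1\le i\le\eta(x)}\min\{n<\Xi^x_p(i):S^x_n(i)=y\}$ for $x\ne y$ ($\infty$ if there is no such $n$), and $T(x)=\inf\{t(x_0,x_1)+\dots+t(x_{m-1},x_m)\}$ over all finite sequences $\mathbf{0}=x_0,x_1,\dots,x_m=x$, with $T(\mathbf{0})=0$; $T(x)=\infty$ means that $x$ is never visited by active particles. The root is hit infinitely often if there are infinitely many times at which some active particle is located at $\mathbf{0}$. Define $p_u(\mathcal{G},\eta)=\inf\{p\in[0,1]:\mathbf{P}[\mathbf{0}\text{ is hit infinitely often in }\mathrm{FM}(\mathcal{G},p,\eta)]>0\}$, with the convention $\inf\emptyset=1$. *)

(* Defs.v *)
From HB Require Import structures.
From mathcomp Require Import all_boot all_order all_algebra finmap.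
From mathcomp Require Import all_classical all_reals all_analysis measurable_realfun.
Set Implicit Arguments.
Unset Strict Implicit.
Unset Printing Implicit Defensive.
Import Order.TTheory GRing.Theory Num.Theory.
Import numFieldNormedType.Exports.
Local Open Scope classical_set_scope.
Local Open Scope ring_scope.

Definition Zd_adj (d : nat) : rel 'rV[int]_d :=
  fun x y => \sum_(i < d) `|x ord0 i - y ord0 i| == 1.

(* Graphs are given by their adjacency relation; [fset_set] is empty on
   infinite sets, so this is the degree only at sites of finite degree. *)
Definition degree (V : choiceType) (e : rel V) (x : V) : nat :=
  #|` fset_set [set y | e x y] |%fset.

Section Probability.
Context {disp : measure_display} {T : measurableType disp} {R : realType}.
Variable P : probability T R.

Definition mutually_independent (I : choiceType) (F : I -> set (set T)) : Prop :=
  forall (J : {fset I}) (E : I -> set T),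
    (forall j, j \in J -> F j (E j)) ->
    P (\bigcap_(j in [set` J]) E j) = (\prod_(j <- J) P (E j))%E.

(* For V countable, the sigma-algebra generated by the V-valued process X. *)
Definition process_sigma (V : Type) (X : nat -> T -> V) : set (set T) :=
  <<s [set A | exists n v, A = X n @^-1` [set v]] >>.

Definition simple_random_walk (V : countType) (e : rel V) (x : V)
    (X : nat -> T -> V) : Prop :=
  (forall n v, measurable (X n @^-1` [set v])) /\
  (forall (n : nat) (v : nat -> V),
    P [set w | forall k, (k <= n)%N -> X k w = v k] =
    ((v 0%N == x)%:R *
     \prod_(k < n) (if e (v k) (v k.+1) then (degree e (v k))%:R^-1 else 0))%:E).

(* The first clause has total mass 1 for p < 1 and 0 for p = 1. *)
Definition geometric_lifetime (p : R) (X : {RV P >-> \bar R}) : Prop :=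
  (forall k : nat,
    P (X @^-1` [set k.+1%:R%:E]) = ((1 - p) * p ^+ k)%:E) /\
  (p = 1 -> P (X @^-1` [set +oo%E]) = 1%E).

(* The particles of a site are numbered from 0 instead of 1.  The lifetimes
   for all p live on the same space, but nothing is assumed on their joint
   law for different values of p, nor on lifetimes p x i for p outside [0, 1]. *)
Record frog_model (V : countType) (e : rel V) (eta : {RV P >-> nat}) := FrogModel {
  sleepers : V -> {RV P >-> nat} ;
  walk : V -> nat -> nat -> T -> V ;
  lifetime : R -> V -> nat -> {RV P >-> \bar R} ;
  sleepers_law : forall x, distribution P (sleepers x) =1 distribution P eta ;
  walk_law : forall x i, simple_random_walk e x (walk x i) ;
  lifetime_law : forall p x i, 0 <= p <= 1 -> geometric_lifetime p (lifetime p x i) ;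
  frog_independence : forall p, 0 <= p <= 1 ->
    mutually_independent (fun j : V + (V * nat + V * nat) =>
      match j with
      | inl x => preimage_set_system setT (sleepers x) measurable
      | inr (inl (x, i)) => process_sigma (walk x i)
      | inr (inr (x, i)) => preimage_set_system setT (lifetime p x i) measurable
      end)
}.

Section FrogModel.
Variables (V : countType) (e : rel V) (eta : {RV P >-> nat}).
Variables (FM : frog_model e eta) (root : V).
Local Open Scope ereal_scope.

(* t(x, y).  For x = y this is 0 or +oo, which does not affect the infimum
   defining the activation times. *)
Definition passage_time (p : R) (w : T) (x y : V) : \bar R :=
  ereal_inf [set z | exists i n : nat,
    [/\ (i < sleepers FM x w)%N, n%:R%:E < lifetime FM p x i w,
        walk FM x i n w = y & z = n%:R%:E]].

(* T(x): the sequence x_0 = root, x_1, ..., x_m is encoded by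
   s = [:: x_1; ...; x_m]. *)
Definition activation_time (p : R) (w : T) (x : V) : \bar R :=
  ereal_inf [set \sum_(z <- pairmap (passage_time p w) root s) z
            | s in [set s : seq V | last root s = x]].

Definition active_at (p : R) (w : T) (m : nat) (y : V) : Prop :=
  exists (x : V) (i n : nat),
    [/\ (i < sleepers FM x w)%N, n%:R%:E < lifetime FM p x i w,
        walk FM x i n w = y & activation_time p w x + n%:R%:E = m%:R%:E].

Definition root_hit_infinitely_often (p : R) : set T :=
  [set w | infinite_set [set m : nat | active_at p w m root]].

(* The library's [inf set0] is 0, whereas here the infimum of the empty set
   is 1. *)
Definition p_u : R :=
  let A := [set p : R | (0 <= p <= 1)%R /\ 0 < P (root_hit_infinitely_often p)] in
  if `[< A = set0 >] then 1%R else inf A.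

End FrogModel.
End Probability.

(* Main.v *)
(* Fix p in (0,1) and let A_k be the cube [2^k, 2^(k+1))^d and N_k = B^(2^k).
   A given particle follows a geodesic of length n to its end with probability
   at least (1-p)(p/3^d)^n, since degrees are at most 3^d.  For B large, the
   N_k particles of a site of A_k u {0} therefore reach every site of
   A_{k+1} u {0}, up to a probability doubly exponentially small in k.  The
   tail of eta is heavy enough for A_k to contain a site with at least N_k
   particles, up to a probability exp(-c 2^{k(d-beta)}).  Starting from the
   event that the root itself has N_{k0} particles, which is independent of
   everything that may go wrong later, a union bound shows that with positive
   probability each level activates a rich site of the next one and sends a
   particle back to the root; the latter travels for at least 2^k steps, so the
   root is hit at arbitrarily late times. *)

Require Import Defs.
From HB Require Import structures.
From mathcomp Require Import all_boot all_order all_algebra finmap.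
From mathcomp Require Import all_classical all_reals all_analysis measurable_realfun.
From mathcomp Require Import ring lra zify.
Import Order.TTheory GRing.Theory Num.Theory.
Import numFieldNormedType.Exports.
Local Open Scope classical_set_scope.
Local Open Scope ring_scope.
Set Implicit Arguments.
Unset Strict Implicit.
Unset Printing Implicit Defensive.

(** * Independence *)

Section Independence.
Context {disp : measure_display} {T : measurableType disp} {R : realType}.
Variable P : probability T R.

Lemma mutually_independent_seq (I : choiceType) (F : I -> set (set T))
    (s : seq I) (E : I -> set T) :
  mutually_independent P F -> uniq s -> (forall j, j \in s -> F j (E j)) ->
  P (\bigcap_(j in [set` s]) E j) = (\prod_(j <- s) P (E j))%E.
Proof.
move=> hF us FE; have sJ : s =i [fset j in s]%fset by move=> j; rewrite inE.
have -> : [set` s] = [set` [fset j in s]%fset].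
  by apply/seteqP; split=> j /=; rewrite sJ.
rewrite hF => [|j]; last by rewrite -sJ; exact: FE.
by apply/perm_big/uniq_perm => //; exact: fset_uniq.
Qed.

(** The complement of [E (a i) & E (b i)] lies in none of the families [F], so independence does not
    apply to it directly. Inclusion-exclusion one pair at a time, P(X \ C) = P(X) - P(X & C),
    expresses everything through finite intersections of the [E j]. Below, [a i] and [b i] are the
    walk and the lifetime of one particle. *)
Lemma mutually_independent_avoid_pairs (I : choiceType) (F : I -> set (set T))
    (E : I -> set T) (r : I -> R) (a b : nat -> I) (n : nat) (J : {fset I}) :
  mutually_independent P F ->
  (forall i, F i (E i)) -> (forall i, measurable (E i)) ->
  (forall i, P (E i) = (r i)%:E) ->
  injective a -> injective b -> (forall i k, a i != b k) ->
  (forall i, a i \notin J) -> (forall i, b i \notin J) ->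
  P (\bigcap_(j in [set` J]) E j `&` \bigcap_(i < n) ~` (E (a i) `&` E (b i)))
  = (\prod_(j <- J) r j * \prod_(i < n) (1 - r (a i) * r (b i)))%:E.
Proof.
move=> hF FE mE PE aI bI ab.
have mC (K : {fset I}) m : measurable (\bigcap_(j in [set` K]) E j `&`
    \bigcap_(i < m) ~` (E (a i) `&` E (b i))).
  apply: measurableI.
    by apply: fin_bigcap_measurable => // j _; exact: mE.
  apply: fin_bigcap_measurable; first exact: finite_II.
  by move=> i _; apply: measurableC; exact: measurableI.
(* The induction adds [a m] and [b m] to the finite set, so the set must vary and only the indices
   below [m] can be required to avoid it. *)
suff H (K : {fset I}) m : (forall i, (i < m)%N -> a i \notin K) ->
    (forall i, (i < m)%N -> b i \notin K) ->
    P (\bigcap_(j in [set` K]) E j `&` \bigcap_(i < m) ~` (E (a i) `&` E (b i)))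
    = (\prod_(j <- K) r j * \prod_(i < m) (1 - r (a i) * r (b i)))%:E.
  by move=> aJ bJ; apply: H => i _; [exact: aJ|exact: bJ].
elim: m K => [|m IH] K aK bK.
  rewrite II0 bigcap_set0 setIT big_ord0 mulr1 hF; last by move=> *; exact: FE.
  by rewrite -prodEFin; apply: eq_bigr => j _; exact: PE.
set X := \bigcap_(j in [set` K]) E j `&` \bigcap_(i < m) ~` (E (a i) `&` E (b i)).
pose K' := (a m |` (b m |` K))%fset.
have -> : \bigcap_(j in [set` K]) E j `&`
    \bigcap_(i < m.+1) ~` (E (a i) `&` E (b i)) = X `\` (E (a m) `&` E (b m)).
  apply/seteqP; split=> w /=.
    move=> [wK wm]; split; last exact: (wm m (ltnSn m)).
    by split=> // i im; apply: wm => /=; apply: ltnW.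
  move=> [[wK wm] nw]; split=> // i /=; rewrite ltnS leq_eqVlt => /orP[/eqP -> //|].
  exact: wm.
have bmK : b m \notin K by exact: bK.
have amK : a m \notin (b m |` K)%fset.
  by rewrite in_fset1U negb_or ab /=; exact: aK.
have XK' : X `&` (E (a m) `&` E (b m)) =
    \bigcap_(j in [set` K']) E j `&` \bigcap_(i < m) ~` (E (a i) `&` E (b i)).
  apply/seteqP; split=> w /=.
    move=> [[wK wm] [wa wb]]; split=> // j /=; rewrite !in_fset1U.
    by move=> /or3P[/eqP ->|/eqP ->|/wK].
  move=> [wK wm]; split; first split=> //.
    by move=> j jK; apply: wK; rewrite /= !in_fset1U jK !orbT.
  by split; apply: wK; rewrite /= !in_fset1U eqxx ?orbT.
have PD A B : measurable A -> measurable B -> P (A `\` B) = (P A - P (A `&` B))%E.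
  by move=> mA mB; apply: measureD => //; exact: le_lt_trans (probability_le1 _ mA) (ltry _).
have aK1 i : (i < m)%N -> a i \notin K by move=> im; apply: aK; apply: ltnW.
have bK1 i : (i < m)%N -> b i \notin K by move=> im; apply: bK; apply: ltnW.
have aK' i : (i < m)%N -> a i \notin K'.
  move=> im; rewrite !in_fset1U !negb_or (inj_eq aI) ab /=.
  by rewrite (ltn_eqF im) /= aK1.
have bK' i : (i < m)%N -> b i \notin K'.
  move=> im; rewrite !in_fset1U !negb_or (inj_eq bI) eq_sym ab /=.
  by rewrite (ltn_eqF im) /= bK1.
rewrite PD; [|exact: mC|exact: measurableI].
rewrite XK' (IH _ aK1 bK1) (IH _ aK' bK').
rewrite big_ord_recr /= -EFinB; congr (_%:E).
by rewrite !big_fsetU1 //=; ring.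
Qed.

End Independence.

(** * Activation times *)

Lemma infinite_set_natP (A : set nat) :
  infinite_set A <-> forall n, exists2 m, (n <= m)%N & A m.
Proof.
split=> [Ainf n|Aunb /finite_fsetP[X AX]]; last first.
  have [m Xm Am] := Aunb (\max_(i <- X) i).+1.
  have mX : m \in X by move: Am; rewrite AX.
  by have := @leq_bigmax_seq _ (X : seq nat) xpredT id m mX isT; rewrite leqNgt Xm.
apply: contrapT => noA; apply: Ainf; apply: (sub_finite_set _ (finite_II n)).
by move=> m Am /=; rewrite ltnNge; apply/negP => nm; apply: noA; exists m.
Qed.

Section ExtendedNaturals.
Context {R : realType}.
Local Open Scope ereal_scope.

(** The range of the activation times. [active_at] only speaks of integer times, so a finite
    activation time must be known to be an integer. *)
Definition extended_natural : set (\bar R) :=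
  [set z | z = +oo \/ exists n : nat, z = n%:R%:E].

Lemma extended_naturalD (x y : \bar R) :
  extended_natural x -> extended_natural y -> extended_natural (x + y).
Proof.
move=> [->|[n ->]] [->|[m ->]]; try by left; rewrite ?addye ?addey.
by right; exists (n + m)%N; rewrite natrD EFinD.
Qed.

(** Either [S] contains no natural number and the infimum is infinite, or it is attained at the
    least natural number of [S]. *)
Lemma extended_natural_ereal_inf (S : set (\bar R)) :
  S `<=` extended_natural -> extended_natural (ereal_inf S).
Proof.
move=> Snat; have [[n0 Sn0]|noS] := pselect (exists n : nat, S n%:R%:E); last first.
  left; apply/eqP; rewrite -leye_eq; apply: le_ereal_inf_tmp => z Sz.
  have [->//|[n zn]] := Snat _ Sz.
  by case: noS; exists n; rewrite -zn.
have Pn0 : exists n, `[< S n%:R%:E >] by exists n0; exact/asboolP.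
case: (ex_minnP Pn0) => m /asboolP Sm minm; right; exists m.
apply/eqP; rewrite eq_le; apply/andP; split; first exact: ereal_inf_lbound.
apply: le_ereal_inf_tmp => z Sz; have [->|[n zn]] := Snat _ Sz; first exact: leey.
by rewrite zn lee_fin ler_nat minm //; apply/asboolP; rewrite -zn.
Qed.

End ExtendedNaturals.

Section FrogModelPaths.
Context {disp : measure_display} {T : measurableType disp} {R : realType}.
Variable P : probability T R.
Variables (V : countType) (e : rel V) (eta : {RV P >-> nat}).
Variables (FM : frog_model e eta) (root : V) (p : R).
Local Open Scope ereal_scope.

Lemma extended_natural_passage_time w x y :
  extended_natural (passage_time FM p w x y).
Proof.
by apply: extended_natural_ereal_inf => z [i [n [_ _ _ ->]]]; right; exists n.
Qed.

Lemma extended_natural_activation_time w x :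
  extended_natural (activation_time FM root p w x).
Proof.
apply: extended_natural_ereal_inf => _ [s _ <-].
elim: s (root) => [|y s IH] z /=; first by rewrite big_nil; right; exists 0%N.
rewrite big_cons; apply: extended_naturalD; last exact: IH.
exact: extended_natural_passage_time.
Qed.

Lemma passage_time_ltey w x y (i n : nat) :
  (i < sleepers FM x w)%N -> n%:R%:E < lifetime FM p x i w ->
  walk FM x i n w = y -> passage_time FM p w x y < +oo.
Proof.
move=> ix nx xy; apply: le_lt_trans (ltry n%:R).
by apply: ereal_inf_lbound; exists i, n.
Qed.

Lemma activation_time_root w : activation_time FM root p w root < +oo.
Proof.
apply: le_lt_trans (ltry 0); apply: ereal_inf_lbound; exists [::] => //=.
by rewrite big_nil.
Qed.

Lemma activation_time_ltey_trans w x y :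
  activation_time FM root p w x < +oo -> passage_time FM p w x y < +oo ->
  activation_time FM root p w y < +oo.
Proof.
move=> /ereal_inf_ltP[_ [s /= sx <-] sfin] xy.
apply/ereal_inf_ltP.
exists (\sum_(z <- pairmap (passage_time FM p w) root (rcons s y)) z).
  by exists (rcons s y) => //=; rewrite last_rcons.
rewrite -cats1 pairmap_cat big_cat /= big_seq1 sx.
exact: lte_add_pinfty.
Qed.

(** The particle is at [y] at time T(x) + n, which is at least [n]: long journeys force late visits,
    with no control on T(x) beyond its finiteness. *)
Lemma active_at_late w x y (i n : nat) :
  activation_time FM root p w x < +oo ->
  (i < sleepers FM x w)%N -> n%:R%:E < lifetime FM p x i w ->
  walk FM x i n w = y -> exists2 m, (n <= m)%N & active_at FM root p w m y.
Proof.
move=> xfin ix nx xy.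
have [xoo|[k xk]] := extended_natural_activation_time w x.
  by rewrite xoo in xfin.
exists (k + n)%N; first exact: leq_addl.
by exists x, i, n; split=> //; rewrite xk natrD EFinD.
Qed.

(** * Measurability of the root-hit event *)

Lemma measurable_fun_ltP (f : T -> \bar R) :
  (forall c : R, measurable [set w | f w < c%:E]) ->
  measurable_fun [set: T] f.
Proof.
move=> mf; apply: (measurability _ (ErealGenInftyO.measurableE R)).
by move=> _ /= [_ [r ->] <-]; rewrite setTI; exact: mf.
Qed.

Lemma measurable_sleepers x (i : nat) :
  measurable [set w | (i < sleepers FM x w)%N].
Proof.
rewrite (_ : [set _ | _] = sleepers FM x @^-1` [set k | (i < k)%N]) //.
exact: measurable_funPTI.
Qed.

Lemma measurable_lifetime x i (n : nat) :
  measurable [set w | n%:R%:E < lifetime FM p x i w].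
Proof.
rewrite (_ : [set _ | _] = lifetime FM p x i @^-1` `]n%:R%:E, +oo]%classic).
  by apply: measurable_funPTI; exact: emeasurable_itv.
by apply/seteqP; split => w /=; rewrite in_itv /= leey andbT.
Qed.

Lemma measurable_walk x i n y : measurable [set w | walk FM x i n w = y].
Proof. by have [+ _] := walk_law FM x i; exact. Qed.

Lemma measurable_passage_time x y :
  measurable_fun [set: T] (fun w => passage_time FM p w x y).
Proof.
apply: measurable_fun_ltP => c.
rewrite (_ : [set _ | _] = \bigcup_i \bigcup_n
    (([set w | (i < sleepers FM x w)%N] `&`
     [set w | n%:R%:E < lifetime FM p x i w]) `&`
     ([set w | walk FM x i n w = y] `&` [set w | n%:R%:E < c%:E]))).
  apply: bigcupT_measurable => i; apply: bigcupT_measurable => n.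
  apply: measurableI; apply: measurableI.
  - exact: measurable_sleepers.
  - exact: measurable_lifetime.
  - exact: measurable_walk.
  - have [nc|nc] := pselect (n%:R%:E < c%:E).
      by rewrite (_ : [set _ | _] = setT) //; apply/seteqP; split.
    by rewrite (_ : [set _ | _] = set0) //; apply/seteqP; split.
apply/seteqP; split => w /=.
  by move=> /ereal_inf_ltP[_ [i [n [ix nx xy ->]]] nc]; exists i => //; exists n.
move=> [i _ [n _ [[ix nx] [xy nc]]]]; apply/ereal_inf_ltP.
by exists n%:R%:E => //; exists i, n.
Qed.

Lemma measurable_activation_time x :
  measurable_fun [set: T] (fun w => activation_time FM root p w x).
Proof.
apply: measurable_fun_ltP => c.
(* An infimum is below [c] exactly when one of its terms is, and there are only countably many
   finite sequences of sites. *)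
rewrite (_ : [set _ | _] = \bigcup_s
    [set w | last root s = x /\
      \sum_(z <- pairmap (passage_time FM p w) root s) z < c%:E]).
  apply: countable_bigcupT_measurable => [|s]; first exact: countableP.
  have [sx|sx] := eqVneq (last root s) x; last first.
    by rewrite (_ : [set _ | _] = set0) //; apply/seteqP; split=> // w /= [/eqP];
      rewrite (negPf sx).
  rewrite (_ : [set _ | _] = [set: T] `&` [set w |
      \sum_(z <- pairmap (passage_time FM p w) root s) z < c%:E]); last first.
    by rewrite setTI; apply/seteqP; split=> w //= [].
  apply: emeasurable_fun_infty_o => //.
  elim: s {sx} (root) => [|y s IH] z /=.
    by under eq_fun do rewrite big_nil; exact: measurable_cst.
  under eq_fun do rewrite big_cons.
  by apply: emeasurable_funD => //; exact: measurable_passage_time.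
apply/seteqP; split => w /=.
  by move=> /ereal_inf_ltP[_ [s /= sx <-] sc]; exists s.
move=> [s _ [sx sc]]; apply/ereal_inf_ltP.
by exists (\sum_(z <- pairmap (passage_time FM p w) root s) z) => //; exists s.
Qed.

Lemma measurable_active_at m y :
  measurable [set w | active_at FM root p w m y].
Proof.
rewrite (_ : [set _ | _] = \bigcup_x \bigcup_i \bigcup_n
    (([set w | (i < sleepers FM x w)%N] `&`
     [set w | n%:R%:E < lifetime FM p x i w]) `&`
     ([set w | walk FM x i n w = y] `&`
      [set w | activation_time FM root p w x + n%:R%:E = m%:R%:E]))).
  apply: countable_bigcupT_measurable => [|x]; first exact: countableP.
  apply: bigcupT_measurable => i; apply: bigcupT_measurable => n.
  apply: measurableI; apply: measurableI.
  - exact: measurable_sleepers.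
  - exact: measurable_lifetime.
  - exact: measurable_walk.
  - rewrite -[X in measurable X]setTI.
    have mf : measurable_fun [set: T] (fun w =>
        activation_time FM root p w x + n%:R%:E).
      apply: emeasurable_funD; first exact: measurable_activation_time.
      exact: measurable_cst.
    by apply: (mf _ [set m%:R%:E]) => //; exact: emeasurable_set1.
apply/seteqP; split => w /=.
  by move=> [x [i [n [ix nx xy xm]]]]; exists x => //; exists i => //; exists n.
by move=> [x _ [i _ [n _ [[ix nx] [xy xm]]]]]; exists x, i, n.
Qed.

Lemma measurable_root_hit_infinitely_often :
  measurable (root_hit_infinitely_often FM root p).
Proof.
rewrite (_ : root_hit_infinitely_often FM root p = \bigcap_n
    \bigcup_(m in [set m | (n <= m)%N]) [set w | active_at FM root p w m root]).
  apply: bigcapT_measurable => n; apply: bigcup_measurable => m _.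
  exact: measurable_active_at.
apply/seteqP; split=> w /=.
  move=> /infinite_set_natP wA n _; have [m nm mA] := wA n.
  by exists m.
by move=> wA; apply/infinite_set_natP => n; have [m nm mA] := wA n I; exists m.
Qed.

End FrogModelPaths.

(** * Geometry of the lattice *)

Section Lattice.
Variable d : nat.
Implicit Types x y : 'rV[int]_d.

Definition l1_dist x y : nat := (\sum_(i < d) `|x ord0 i - y ord0 i|)%N.

Lemma Zd_adjE x y : Zd_adj x y = (l1_dist x y == 1%N).
Proof.
rewrite /Zd_adj (_ : \sum_(i < d) _ = (l1_dist x y)%:Z) //.
by rewrite /l1_dist (big_morph Posz PoszD (erefl 0)); apply: eq_bigr => i _; rewrite abszE.
Qed.

Lemma leq_l1_dist x y i : (`|x ord0 i - y ord0 i| <= l1_dist x y)%N.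
Proof. by rewrite /l1_dist (bigD1 i) //= leq_addr. Qed.

Lemma l1_dist_eq0 x y : l1_dist x y = 0%N -> x = y.
Proof.
move=> xy; apply/rowP => i; rewrite -[0]/ord0.
by have := leq_l1_dist x y i; rewrite xy; lia.
Qed.

(** Induction on the distance: a unit step towards [y] in a coordinate where [x] and [y] differ
    lowers the distance by exactly one. *)
Lemma Zd_path x y : exists v : nat -> 'rV[int]_d,
  [/\ v 0%N = x, v (l1_dist x y) = y &
      forall k, (k < l1_dist x y)%N -> Zd_adj (v k) (v k.+1)].
Proof.
move: {-2}(l1_dist x y) (erefl (l1_dist x y)) => n; elim: n x => [|n IH] x xyn.
  by exists (fun=> x); split=> //; apply: l1_dist_eq0.
have [i xyi] : exists i, x ord0 i != y ord0 i.
  apply: contrapT => /forallNP xy; move: xyn; rewrite /l1_dist big1 // => i _.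
  by have /negP := xy i; rewrite negbK => /eqP ->; rewrite subrr.
pose s : int := if x ord0 i < y ord0 i then 1 else -1.
pose x' : 'rV[int]_d := \row_j (x ord0 j + (if j == i then s else 0)).
have x'y : l1_dist x' y = n.
  move: xyn; rewrite /l1_dist (bigD1 i) //= [in X in _ -> X](bigD1 i) //= => xyn.
  rewrite (eq_bigr (fun j => `|x ord0 j - y ord0 j|)%N); last first.
    by move=> j ji; rewrite mxE (negPf ji) addr0.
  rewrite !mxE eqxx /s; move: xyn xyi; set S := (\sum_(_ < _ | _) _)%N.
  by case: ifP; lia.
have [v [v0 vn vadj]] := IH _ (esym x'y).
exists (fun k => if k is k'.+1 then v k' else x); split=> // -[_|k kn]; last exact: vadj.
rewrite Zd_adjE v0 /l1_dist (bigD1 i) //= big1.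
  by rewrite mxE eqxx /s; case: ifP; lia.
by move=> j ji; rewrite mxE (negPf ji) addr0 subrr.
Qed.

(** The cube of side 3 centred at [x]: it contains more than the neighbours, but its 3^d points are
    trivial to count and bound the degree. *)
Definition Zd_neighbors x : seq 'rV[int]_d :=
  [seq \row_i (x ord0 i + (g i)%:Z - 1) | g : {ffun 'I_d -> 'I_3}].

Lemma Zd_adj_neighbors x y : Zd_adj x y -> y \in Zd_neighbors x.
Proof.
rewrite Zd_adjE => /eqP xy; apply/mapP.
exists [ffun i => inord (absz (y ord0 i - x ord0 i + 1))]; first by rewrite mem_enum.
apply/rowP => i; rewrite -[0]/ord0 mxE ffunE inordK;
  by have := leq_l1_dist x y i; rewrite xy;
     move: (x ord0 i) (y ord0 i) => a b; lia.
Qed.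

Lemma finite_Zd_adj x : finite_set [set y | Zd_adj x y].
Proof.
apply: (@sub_finite_set _ _ [set` Zd_neighbors x]); last exact: finite_seq.
exact: Zd_adj_neighbors.
Qed.

Lemma degree_Zd_gt0 x y : Zd_adj x y -> (0 < degree (@Zd_adj d) x)%N.
Proof.
move=> xy; rewrite /degree cardfs_gt0; apply/fset0Pn; exists y.
by rewrite in_fset_set; [rewrite inE|exact: finite_Zd_adj].
Qed.

Lemma degree_Zd_le x : (degree (@Zd_adj d) x <= 3 ^ d)%N.
Proof.
have -> : (3 ^ d = size (Zd_neighbors x))%N.
  by rewrite size_map -cardE card_ffun !card_ord.
apply: uniq_leq_size; first exact: fset_uniq.
move=> y; rewrite in_fset_set; last exact: finite_Zd_adj.
by rewrite inE => /Zd_adj_neighbors.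
Qed.

(** * Dyadic cubes and distances between them *)

Definition box k : seq 'rV[int]_d :=
  [seq \row_i (2 ^ k + g i)%N%:Z | g : {ffun 'I_d -> 'I_(2 ^ k)}].

Lemma size_box k : size (box k) = ((2 ^ k) ^ d)%N.
Proof. by rewrite size_map -cardE card_ffun !card_ord. Qed.

Lemma uniq_box k : uniq (box k).
Proof.
rewrite map_inj_uniq ?enum_uniq // => g h /rowP gh.
by apply/ffunP => i; apply/val_inj; have := gh i; rewrite !mxE /=; lia.
Qed.

Lemma box_bounds k x i : x \in box k -> (2 ^ k)%N%:Z <= x ord0 i < (2 ^ k.+1)%N%:Z.
Proof.
move=> /mapP[g _ ->]; rewrite mxE; have := ltn_ord (g i).
by rewrite expnS; move: (2 ^ k)%N (nat_of_ord _) => a b; lia.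
Qed.

Lemma zero_notin_box k : (0 < d)%N -> 0 \notin box k.
Proof.
move=> d0; apply/negP => /(@box_bounds _ _ (Ordinal d0)).
by rewrite mxE => /andP[]; have := expn_gt0 2 k; lia.
Qed.

Lemma l1_dist_box0 k x : (0 < d)%N -> x \in box k -> (2 ^ k <= l1_dist x 0)%N.
Proof.
move=> d0 /(@box_bounds _ _ (Ordinal d0)).
have := leq_l1_dist x 0 (Ordinal d0); rewrite mxE.
by lia.
Qed.

(** All coordinates of both points lie in [0, 2^(k+2)). The origin is allowed as the starting point
    of the chain and as the target of the returning particles. *)
Lemma l1_dist_box k x y : x \in 0 :: box k -> y \in 0 :: box k.+1 ->
  (l1_dist x y <= d * 4 * 2 ^ k)%N.
Proof.
move=> xk yk; rewrite -mulnA -[in leqRHS](card_ord d) -sum_nat_const.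
apply: leq_sum => i _.
have : 0 <= x ord0 i < (2 ^ k.+2)%N%:Z.
  move: xk; rewrite inE => /predU1P[->|/(@box_bounds _ _ i)].
    by rewrite mxE; have := expn_gt0 2 k.+2; lia.
  by rewrite !expnS; lia.
have : 0 <= y ord0 i < (2 ^ k.+2)%N%:Z.
  move: yk; rewrite inE => /predU1P[->|/(@box_bounds _ _ i)].
    by rewrite mxE; have := expn_gt0 2 k.+2; lia.
  by rewrite !expnS; lia.
by rewrite !expnS; lia.
Qed.

End Lattice.

(** * Probability of good and bad events *)

Section FollowingAPath.
Context {disp : measure_display} {T : measurableType disp} {R : realType}.
Variable P : probability T R.
Variable V : countType.
Implicit Types (X : nat -> T -> V) (v : nat -> V).

Definition follows X v (n : nat) : set T :=
  [set w | forall k, (k <= n)%N -> X k w = v k].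

Lemma followsE X v n :
  follows X v n = \bigcap_(k in `I_n.+1) X k @^-1` [set v k].
Proof. by apply/seteqP; split=> w h k /= kn; exact: h. Qed.

Lemma process_sigma_follows X v n : process_sigma X (follows X v n).
Proof.
rewrite followsE -[X in process_sigma _ X]setCK setC_bigcap.
apply: sigma_algebraC; rewrite bigcup_mkcond; apply: sigma_algebra_bigcup => k.
case: ifPn => _; last exact: sigma_algebra0.
by apply: sigma_algebraC; apply: sub_sigma_algebra; exists k, (v k).
Qed.

Lemma measurable_follows (e : rel V) x X v n :
  simple_random_walk P e x X -> measurable (follows X v n).
Proof.
move=> [mX _]; rewrite followsE.
by apply: fin_bigcap_measurable; [exact: finite_II|move=> k _; exact: mX].
Qed.

(** A prescribed path has as probability the product of the inverse degrees along it, each at least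
    1/D. *)
Lemma follows_ge (e : rel V) x X v n (D : nat) :
  simple_random_walk P e x X -> v 0%N = x ->
  (forall k, (k < n)%N -> e (v k) (v k.+1) /\ (0 < degree e (v k) <= D)%N) ->
  ((D%:R ^- n)%:E <= P (follows X v n))%E.
Proof.
move=> [_ ->] -> ev; rewrite eqxx mul1r lee_fin.
rewrite -exprVn -[X in _ ^+ X](card_ord n) -prodr_const.
apply: ler_prod => k _; have [-> /andP[deg0 degD]] := ev _ (ltn_ord k).
rewrite invr_ge0 ler0n lef_pV2 ?ler_nat // posrE ltr0n //.
exact: leq_trans degD.
Qed.

End FollowingAPath.

Section FrogProbabilities.
Context {disp : measure_display} {T : measurableType disp} {R : realType}.
Variables (P : probability T R) (d : nat) (eta : {RV P >-> nat}).
Variable FM : frog_model (@Zd_adj d) eta.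
Variable p : R.
Hypothesis p01 : 0 < p < 1.
Local Notation V := 'rV[int]_d.
Implicit Types x y : V.

Let p_ge0_le1 : 0 <= p <= 1.
Proof. by case/andP: p01 => /ltW -> /ltW ->. Qed.

Definition tail_prob n : R := fine (P [set w | (n <= eta w)%N]).

Lemma measurable_leq_nat (X : {RV P >-> nat}) n :
  measurable [set w | (n <= X w)%N].
Proof.
by rewrite -[X in measurable X]/(X @^-1` [set k | (n <= k)%N]); exact: measurable_funPTI.
Qed.

Lemma sleepers_leq x n : P [set w | (n <= sleepers FM x w)%N] = (tail_prob n)%:E.
Proof.
rewrite /tail_prob fineK; last by apply: fin_num_measure; exact: measurable_leq_nat.
exact: (sleepers_law FM x [set k | (n <= k)%N]).
Qed.

Lemma sleepers_gtn x n :
  P [set w | (sleepers FM x w < n)%N] = (1 - tail_prob n)%:E.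
Proof.
rewrite (_ : [set _ | _] = ~` [set w | (n <= sleepers FM x w)%N]).
  by rewrite probability_setC ?sleepers_leq //; exact: measurable_leq_nat.
by apply/seteqP; split=> w /=; rewrite ltnNge => /negP.
Qed.

Lemma tail_prob_ge0_le1 n : 0 <= tail_prob n <= 1.
Proof.
by rewrite -!lee_fin -(sleepers_leq 0) measure_ge0 probability_le1 //;
  exact: measurable_leq_nat.
Qed.

Definition geodesic x y : nat -> V := projT1 (cid (Zd_path x y)).

Lemma geodesicP x y : [/\ geodesic x y 0%N = x,
  geodesic x y (l1_dist x y) = y & forall k, (k < l1_dist x y)%N ->
    Zd_adj (geodesic x y k) (geodesic x y k.+1)].
Proof. exact: projT2 (cid (Zd_path x y)). Qed.

Definition follows_geodesic x y i : set T :=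
  follows (walk FM x i) (geodesic x y) (l1_dist x y).

(* Prescribing the exact lifetime, rather than a lower bound for it, only costs
   a factor 1 - p. *)
Definition lives_just_enough x y i : set T :=
  lifetime FM p x i @^-1` [set (l1_dist x y).+1%:R%:E].

(** A sufficient condition for the particle to get from [x] to [y], chosen as the conjunction of a
    walk event and a lifetime event, which are independent with explicit bounds. *)
Definition reach x y i : set T :=
  follows_geodesic x y i `&` lives_just_enough x y i.

Lemma reachP x y i w : reach x y i w ->
  walk FM x i (l1_dist x y) w = y /\
  ((l1_dist x y)%:R%:E < lifetime FM p x i w)%E.
Proof.
have [_ geoE _] := geodesicP x y; move=> [wf wl].
by rewrite (wf _ (leqnn _)) geoE (wl : _ = _) lte_fin ltr_nat.
Qed.

Lemma measurable_follows_geodesic x y i : measurable (follows_geodesic x y i).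
Proof. exact: measurable_follows (walk_law FM x i). Qed.

Lemma measurable_lives x y i : measurable (lives_just_enough x y i).
Proof. by apply: measurable_funPTI; exact: emeasurable_set1. Qed.

Lemma measurable_reach x y i : measurable (reach x y i).
Proof.
by apply: measurableI; [exact: measurable_follows_geodesic|exact: measurable_lives].
Qed.

Lemma follows_geodesic_ge x y i :
  ((3 ^+ d) ^- l1_dist x y <= fine (P (follows_geodesic x y i)))%R.
Proof.
rewrite -lee_fin fineK; last first.
  by apply: fin_num_measure; exact: measurable_follows_geodesic.
have [geo0 _ geoadj] := geodesicP x y.
rewrite -natrX; apply: follows_ge (walk_law FM x i) geo0 _ => k kn.
by split; [exact: geoadj|rewrite degree_Zd_le (degree_Zd_gt0 (geoadj _ kn))].
Qed.

Lemma lives_just_enoughE x y i :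
  P (lives_just_enough x y i) = ((1 - p) * p ^+ l1_dist x y)%:E.
Proof. by have [+ _] := lifetime_law FM x i p_ge0_le1; exact. Qed.

Definition reach_bound (n : nat) : R := (1 - p) * (p / 3 ^+ d) ^+ n.

(** Walks and lifetimes exist for every index [i < N], whether or not [x] holds that many particles,
    so they are independent of the number of particles at the root, even for [x = 0]. The pairs
    avoided are the walk and lifetime events, and the root event contributes the factor
    [tail_prob N0]. *)
Lemma no_reach_le N0 N x y :
  (P ([set w | (N0 <= sleepers FM 0%R w)%N] `&` \bigcap_(i < N) ~` reach x y i)
   <= (tail_prob N0 * (1 - reach_bound (l1_dist x y)) ^+ N)%:E)%E.
Proof.
pose E (j : V + (V * nat + V * nat)) : set T := match j with
  | inl z => [set w | (N0 <= sleepers FM z w)%N]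
  | inr (inl (z, i)) => follows_geodesic z y i
  | inr (inr (z, i)) => lives_just_enough z y i end.
have mE j : measurable (E j).
  case: j => [z|[[z i]|[z i]]] /=.
  - exact: measurable_leq_nat.
  - exact: measurable_follows_geodesic.
  - exact: measurable_lives.
have := @mutually_independent_avoid_pairs _ _ _ P _ _ E (fun j => fine (P (E j)))
  (fun i => inr (inl (x, i))) (fun i => inr (inr (x, i))) N [fset inl 0]%fset
  (@frog_independence _ _ _ _ _ _ _ FM _ p_ge0_le1).
rewrite set_fset1 bigcap_set1 big_seq_fset1 /= => -> //.
- rewrite lee_fin sleepers_leq /=; apply: ler_wpM2l.
    by have /andP[] := tail_prob_ge0_le1 N0.
  rewrite -[X in _ <= _ ^+ X](card_ord N) -prodr_const; apply: ler_prod => i _.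
  have fle1 A : measurable A -> 0 <= fine (P A) <= 1.
    move=> mA; rewrite fine_ge0 //= -lee_fin fineK ?probability_le1 //.
    exact: fin_num_measure.
  have /andP[f0 f1] := fle1 _ (measurable_follows_geodesic x y i).
  have /andP[l0 l1] := fle1 _ (measurable_lives x y i).
  rewrite subr_ge0 mulr_ile1 //= lerD2l lerN2 /reach_bound exprMn exprVn mulrA.
  rewrite mulrC; apply: ler_pM => //.
  - by rewrite mulr_ge0 ?exprn_ge0 ?subr_ge0; case/andP: p_ge0_le1.
  - exact: follows_geodesic_ge.
  - by rewrite lives_just_enoughE.
- case=> [z|[[z i]|[z i]]] /=.
  + by exists [set k | (N0 <= k)%N]; rewrite ?setTI.
  + exact: process_sigma_follows.
  + exists [set (l1_dist z y).+1%:R%:E]; first exact: emeasurable_set1.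
    by rewrite setTI.
- by move=> j; rewrite fineK //; exact: fin_num_measure.
- by move=> i j [].
- by move=> i j [].
- by move=> i; rewrite in_fset1.
- by move=> i; rewrite in_fset1.
Qed.

(** Particle numbers at distinct sites are independent; the root is not in [s], so its factor splits
    off. *)
Lemma all_small_eq N0 N (s : seq V) : uniq (0 :: s) ->
  P ([set w | (N0 <= sleepers FM 0%R w)%N] `&`
     \bigcap_(x in [set` s]) [set w | (sleepers FM x w < N)%N]) =
  (tail_prob N0 * (1 - tail_prob N) ^+ size s)%:E.
Proof.
move=> /= /andP[s0 us].
pose E (j : V + (V * nat + V * nat)) : set T := match j with
  | inl z => if z == 0 then [set w | (N0 <= sleepers FM z w)%N]
             else [set w | (sleepers FM z w < N)%N]
  | inr _ => setT end.
have E0 : E (inl 0) = [set w | (N0 <= sleepers FM 0%R w)%N] by rewrite /= eqxx.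
have Es x : x \in s -> E (inl x) = [set w | (sleepers FM x w < N)%N].
  by move=> xs /=; case: eqVneq => // x0; rewrite -x0 xs in s0.
have := @mutually_independent_seq _ _ _ P _ _ (map inl (0 :: s)) E
  (@frog_independence _ _ _ _ _ _ _ FM _ p_ge0_le1).
rewrite (map_inj_uniq (@inl_inj _ _)) /= s0 us big_cons big_map.
rewrite (_ : \bigcap_(j in _) E j = [set w | (N0 <= sleepers FM 0%R w)%N] `&`
     \bigcap_(x in [set` s]) [set w | (sleepers FM x w < N)%N]); last first.
  apply/seteqP; split=> w /=.
    move=> wE; split; first by have := wE (inl 0); rewrite /= eqxx; apply; rewrite inE eqxx.
    move=> x xs; suff : E (inl x) w by rewrite Es.
    by apply: wE; rewrite /= inE (mem_map (@inl_inj _ _)) [x \in s]xs orbT.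
  move=> [w0 ws] j /predU1P[->|/mapP[x xs ->]]; first by rewrite /= eqxx.
  by rewrite Es //; exact: ws.
move=> -> //.
- rewrite E0 sleepers_leq EFinM; congr (_ * _)%E.
  rewrite big_seq (eq_bigr (fun=> (1 - tail_prob N)%:E)); last first.
    by move=> x xs; rewrite Es // sleepers_gtn.
  by rewrite -big_seq prodEFin big_const_seq count_predT -Monoid.iteropE.
- move=> j; rewrite inE => /predU1P[->|/mapP[x xs ->]].
    by rewrite /= eqxx; exists [set k | (N0 <= k)%N]; rewrite ?setTI.
  by rewrite Es //; exists [set k | (k < N)%N]; rewrite ?setTI.
Qed.

End FrogProbabilities.

(** * Asymptotic estimates *)

Section Estimates.
Context {R : realType}.
Implicit Types (c g h q : R).

Lemma one_minusX_le_expR h n : h <= 1 -> (1 - h) ^+ n <= expR (- (h * n%:R)).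
Proof.
move=> h1; rewrite -mulNr expRM_natr; apply: lerXn2r.
- by rewrite nnegrE subr_ge0.
- by rewrite nnegrE expR_ge0.
- exact: expR_ge1Dx.
Qed.

Lemma near_pow2_ge c : \forall k \near \oo, c <= 2 ^+ k.
Proof.
exists (Num.truncn `|c|).+1 => // k /= ck; apply: le_trans (ler_norm _) _.
apply/ltW/(lt_le_trans (truncnS_gt _)); rewrite -natrX ler_nat.
exact: leq_trans ck (ltnW (ltn_expl _ _)).
Qed.

(** With y = c 2^(kg), keep the single term y^(m+1)/(m+1)! of the exponential series. As g(m+1) >=
    s+1, it exceeds 2^(ks) with a spare factor 2^k, which eventually absorbs (m+1)!/c^(m+1). *)
Lemma near_pow2X_le_expR c g s : 0 < c -> 0 < g ->
  \forall k \near \oo, (2 ^+ k) ^+ s <= expR (c * (2 ^+ k) `^ g).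
Proof.
move=> c0 g0; pose m := Num.truncn (s.+1%:R / g).
have gm : s.+1%:R <= g * m.+1%:R by rewrite mulrC -ler_pdivrMr //; exact/ltW/truncnS_gt.
near=> k.
have k2 : 1 <= 2 ^+ k :> R by rewrite exprn_ege1 // ler1n.
have k0 : 0 <= 2 ^+ k :> R by apply: le_trans k2.
pose y := c * (2 ^+ k) `^ g.
have y0 : 0 <= y by rewrite mulr_ge0 ?powR_ge0 // ltW.
have fm : 0 < (m.+1)`!%:R :> R by rewrite ltr0n fact_gt0.
apply: (@le_trans _ _ (y ^+ m.+1 / (m.+1)`!%:R)); last first.
  by apply: le_trans (expR_ge1Dxn m y0); rewrite lerDr.
rewrite ler_pdivlMr // exprMn -[((2 ^+ k) `^ g) ^+ _]powR_mulrn ?powR_ge0 //.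
rewrite -powRrM; apply: (@le_trans _ _ (c ^+ m.+1 * (2 ^+ k) ^+ s.+1)).
  rewrite [(2 ^+ k) ^+ s.+1]exprSr mulrCA ler_wpM2l ?exprn_ge0 //.
  rewrite -ler_pdivrMl ?exprn_gt0 //.
  by near: k; exact: near_pow2_ge.
rewrite ler_wpM2l ?exprn_ge0 ?(ltW c0) // -[leLHS]powR_mulrn //.
exact: ler_powR.
Unshelve. all: by end_near. Qed.

(** Since ln(B^(2^k)) = 2^k ln B, a site is rich with probability at least c 2^(-k beta), where c =
    (ln B)^(-beta). Over 2^(kd) sites the failure probability is at most exp(-c 2^(k(d-beta))), and
    beta < d. *)
Lemma site_estimate (d : nat) (beta : R) (t : nat -> R) (B : nat) :
  beta < d%:R -> (1 < B)%N -> (forall n, t n <= 1) ->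
  (\forall n \near \oo, 1 / (ln n%:R `^ beta) <= t n) ->
  \forall k \near \oo, (1 - t (B ^ (2 ^ k))%N) ^+ ((2 ^ k) ^ d)%N <= 2 ^- k.+1.
Proof.
move=> betad B1 t1 [n0 _ n0t]; have lnB : 0 < ln B%:R :> R by rewrite ln_gt0 // ltr1n.
pose c := (ln B%:R) `^ (- beta); have c0 : 0 < c by rewrite powR_gt0.
have gap : 0 < d%:R - beta by rewrite subr_gt0.
have large := near_pow2X_le_expR 2 c0 gap.
near=> k.
have k0 : 0 < 2 ^+ k :> R by rewrite exprn_gt0.
have n0k : (n0 <= B ^ (2 ^ k))%N.
  have : (n0 <= k)%N by near: k; exact: nbhs_infty_ge.
  move/leq_trans; apply; apply: leq_trans (ltnW (ltn_expl k (ltnSn 1))) _.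
  exact: ltnW (ltn_expl _ B1).
apply: le_trans (one_minusX_le_expR _ (t1 _)) _.
rewrite expRN lef_pV2 ?posrE ?expR_gt0 ?exprn_gt0 //.
(* For k >= 1, 2^(k+1) <= (2^k)^2, a fixed power of 2^k. *)
apply: (@le_trans _ _ ((2 ^+ k) ^+ 2)).
  rewrite -exprM; apply: ler_weXn2l; first by rewrite ler1n.
  have : (1 <= k)%N by near: k; exact: nbhs_infty_ge.
  by lia.
apply: (@le_trans _ _ (expR (c * (2 ^+ k) `^ (d%:R - beta)))).
  by near: k; exact: large.
rewrite ler_expR; apply: le_trans (ler_wpM2r _ (n0t _ n0k)); last by rewrite ler0n.
rewrite natrX lnXn ?ltr0n ?(ltn_trans _ B1) // -[ln B%:R *+ _]mulr_natl !natrX.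
rewrite (powRM _ (ltW k0) (ltW lnB)) div1r invfM mulrAC powRB ?(gt_eqF k0) ?implybT //.
rewrite powR_mulrn ?(ltW k0) // /c powRN le_eqVlt; apply/orP; left; apply/eqP.
ring.
Unshelve. all: by end_near. Qed.

(** Write K = 2^k. One particle succeeds with probability at least z^K, so B^K particles have at
    least (Bz)^K >= 2^K >= K expected successes. All fail with probability at most e^(-K), which
    beats the number of pairs, polynomial in K. *)
Lemma particle_estimate (d : nat) (p : R) : 0 < p < 1 ->
  exists2 B : nat, (1 < B)%N & \forall k \near \oo, forall n, (n <= d * 4 * 2 ^ k)%N ->
    (((2 ^ k) ^ d).+1 * ((2 ^ k.+1) ^ d).+1)%:R *
      (1 - (1 - p) * (p / 3 ^+ d) ^+ n) ^+ (B ^ (2 ^ k))%N <= 2 ^- k.+1.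
Proof.
move=> /andP[p0 p1]; pose q := p / 3 ^+ d.
have q0 : 0 < q by rewrite divr_gt0 ?exprn_gt0.
have q1 : q <= 1.
  by rewrite ler_pdivrMr ?exprn_gt0 // mul1r (le_trans (ltW p1)) // exprn_ege1 // ler1n.
pose z := (1 - p) * q ^+ (d * 4).
have z0 : 0 < z by rewrite mulr_gt0 ?exprn_gt0 // subr_gt0.
(* One successor makes [B] exceed 2/z; the second ensures 1 < B. *)
pose B := (Num.truncn (2 / z)).+2; exists B => //.
have Bz : 2 <= B%:R * z.
  rewrite -ler_pdivrMr //; apply/ltW/(lt_le_trans (truncnS_gt _)).
  by rewrite ler_nat.
near=> k => n nk.
set K := (2 ^ k)%N; have K0 : (0 < K)%N by rewrite expn_gt0.
have h1 : (1 - p) * q ^+ n <= 1.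
  by rewrite mulr_ile1 ?exprn_ge0 ?exprn_ile1 ?subr_ge0 ?gerBl ?(ltW p0) ?(ltW p1) ?(ltW q0).
have Kh : K%:R <= (1 - p) * q ^+ n * (B ^ K)%N%:R.
  apply: (@le_trans _ _ ((B%:R * z) ^+ K)).
    apply: (@le_trans _ _ (2 ^+ K)); first by rewrite -natrX ler_nat ltnW // ltn_expl.
    by apply: lerXn2r => //; rewrite nnegrE //; apply: le_trans Bz.
  (* Here z^K = (1-p)^K q^(4dK) is compared factor by factor with (1-p) q^n: both bases are at most
     1, K >= 1 and n <= 4dK. *)
  rewrite natrX exprMn mulrC ler_wpM2r ?exprn_ge0 // exprMn -exprM.
  apply: ler_pM; rewrite ?exprn_ge0 ?subr_ge0 ?(ltW p1) ?(ltW q0) //.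
    rewrite -[leRHS]expr1; apply: ler_wiXn2l => //; lra.
  by apply: ler_wiXn2l => //; exact: ltW.
(* As K >= 2, the number of pairs is at most 4 2^d K^(2d) <= K^(3d+2). The target 2^(-k-1) costs at
   most K^2 more, whence the exponent 3d+4 below. *)
apply: (@le_trans _ _ ((2 ^+ k) ^+ (3 * d + 2)%N * expR (- K%:R))).
  apply: ler_pM => //; first by rewrite exprn_ge0 // subr_ge0.
    rewrite -!natrX ler_nat.
    apply: (@leq_trans (2 * K ^ d * (2 * (2 * K) ^ d))).
      rewrite expnS -/K; apply: leq_mul.
        by have := expn_gt0 K d; lia.
      by have := expn_gt0 (2 * K) d; lia.
    have k1 : (1 <= k)%N by near: k; exact: nbhs_infty_ge.
    have k2 : (2 <= K)%N by rewrite -(expn1 2) leq_exp2l.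
    have kd : (2 ^ d <= K ^ d)%N by case: (d) => // d'; rewrite leq_exp2r.
    rewrite expnMn (_ : 3 * d + 2 = d + d + d + 2)%N; last by lia.
    rewrite !expnD -/K (_ : (_ <= _)%N = (2 ^ d * (2 * 2) * (K ^ d * K ^ d) <=
      K ^ d * K ^ 2 * (K ^ d * K ^ d))%N); last by congr (_ <= _)%N; ring.
    by rewrite leq_mul // leq_mul // -mulnn leq_mul.
  by apply: le_trans (one_minusX_le_expR _ h1) _; rewrite ler_expR lerN2.
rewrite expRN ler_pdivrMr ?expR_gt0 // mulrC ler_pdivlMr ?exprn_gt0 //.
apply: (@le_trans _ _ ((2 ^+ k) ^+ (3 * d + 4))).
  rewrite (_ : (3 * d + 4 = 3 * d + 2 + 2)%N); last by lia.
  rewrite [leRHS]exprD ler_wpM2l ?exprn_ge0 // -exprM; apply: ler_weXn2l; first by rewrite ler1n.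
  have : (1 <= k)%N by near: k; exact: nbhs_infty_ge.
  by lia.
have -> : K%:R = 1 * (2 ^+ k) `^ 1 :> R by rewrite mul1r powRr1 ?exprn_ge0 // /K natrX.
by near: k; exact: near_pow2X_le_expR.
Unshelve. all: by end_near. Qed.

End Estimates.

(** * Root hits *)

Section UnionBounds.
Context {disp : measure_display} {T : measurableType disp} {R : realType}.
Variable P : probability T R.

Lemma probabilityU_le (A B : set T) : measurable A -> measurable B ->
  (P (A `|` B) <= P A + P B)%E.
Proof. exact: measureU2. Qed.

Lemma probability_bigsetU_le (I : eqType) (s : seq I) (A : I -> set T) (c : R) :
  (forall i, measurable (A i)) -> (forall i, i \in s -> (P (A i) <= c%:E)%E) ->
  (P (\big[setU/set0]_(i <- s) A i) <= ((size s)%:R * c)%:E)%E.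
Proof.
move=> mA; elim: s => [|i s IH] Ac; first by rewrite big_nil measure0 mul0r.
rewrite big_cons; apply: le_trans (probabilityU_le _ _) _ => //.
  exact: bigsetU_measurable.
rewrite /= -natr1 mulrDl mul1r addrC EFinD; apply: leeD.
  by apply: IH => j js; apply: Ac; rewrite inE js orbT.
by apply: Ac; rewrite inE eqxx.
Qed.

Lemma probability_bigcup_geometric_le (A : (set T)^nat) (c : R) : 0 <= c ->
  (forall n, measurable (A n)) ->
  (forall n, (P (A n) <= (c / (2 ^ n.+1)%:R)%:E)%E) ->
  (P (\bigcup_n A n) <= c%:E)%E.
Proof.
move=> c0 mA Ac.
apply: le_trans (generalized_Boole_inequality _ mA _) _.
  exact: bigcupT_measurable.
have := @epsilon_trick R (fun=> 0%E) c xpredT (fun=> lexx _) c0.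
rewrite [X in (_ <= X + _)%E -> _]eseries0 // add0e; apply: le_trans.
by apply: lee_nneseries => [n _ _|n _] /=; rewrite ?add0e.
Qed.

End UnionBounds.

Section RootHits.
Context {disp : measure_display} {T : measurableType disp} {R : realType}.
Variables (P : probability T R) (d : nat) (eta : {RV P >-> nat}).
Variable FM : frog_model (@Zd_adj d) eta.
Variable p : R.
Hypotheses (p01 : 0 < p < 1) (d_gt0 : (0 < d)%N).
Local Notation V := 'rV[int]_d.

(** The deterministic part, for one outcome [w]: rich sites activate one another from level to
    level, and each level returns a particle to the root. *)
Lemma hit_infinitely_often (N : nat -> nat) k0 w :
  (N k0 <= sleepers FM 0%R w)%N ->
  (forall k, (k0 <= k)%N ->
    exists2 x, x \in box d k & (N k <= sleepers FM x w)%N) ->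
  (forall k x y, (k0 <= k)%N -> x \in 0 :: box d k -> y \in 0 :: box d k.+1 ->
    exists2 i, (i < N k)%N & reach FM p x y i w) ->
  root_hit_infinitely_often FM 0 p w.
Proof.
move=> N0 big reachable.
(* At j = 0 the site is the root itself. From j = 1 on it lies in the cube, hence far from the
   root. *)
have chain j : exists x : V, [/\ x \in 0 :: box d (k0 + j),
    (0 < j)%N -> x \in box d (k0 + j), (N (k0 + j) <= sleepers FM x w)%N &
    (activation_time FM 0%R p w x < +oo)%E].
  elim: j => [|j [x [xj _ Nx xfin]]].
    exists 0; rewrite addn0; split=> //; first by rewrite inE eqxx.
    exact: activation_time_root.
  have [y yj Ny] := big (k0 + j.+1)%N (leq_addr _ _).
  have yj' : y \in 0 :: box d (k0 + j.+1) by rewrite inE yj orbT.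
  exists y; split=> //; rewrite addnS in yj'.
  have [i iN /reachP[xy lx]] := reachable _ _ _ (leq_addr _ _) xj yj'.
  apply: activation_time_ltey_trans xfin _.
  exact: passage_time_ltey (leq_trans iN Nx) lx xy.
apply/infinite_set_natP => n.
(* Level [k0 + n.+1] is positive in [j], and its distance to the root is at least 2^(k0+n+1) >=
   n. *)
have [x [xn /(_ isT) xbox Nx xfin]] := chain n.+1.
have zbox : 0 \in 0 :: box d (k0 + n.+1).+1 by rewrite inE eqxx.
have [i iN /reachP[x0 lx]] := reachable _ _ _ (leq_addr _ _) xn zbox.
have [m nm mhit] := active_at_late xfin (leq_trans iN Nx) lx x0.
exists m => //; apply: leq_trans nm; apply: leq_trans (l1_dist_box0 d_gt0 xbox).
apply: leq_trans (ltnW (ltn_expl _ (ltnSn 1))).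
by rewrite addnS ltnW // ltnS leq_addl.
Qed.

Lemma hit_probability_gt0 (beta : R) : beta < d%:R ->
  (\forall n \near \oo, (1 / ln (n%:R : R) `^ beta) <= tail_prob eta n) ->
  (0 < P (root_hit_infinitely_often FM 0%R p))%E.
Proof.
move=> betad tailP.
have [B B1 particle] := particle_estimate d p01.
have tail1 n : tail_prob eta n <= 1 by have /andP[] := tail_prob_ge0_le1 FM n.
have site := site_estimate betad B1 tail1 tailP.
pose N k := (B ^ (2 ^ k))%N.
have [n0 _ n0tail] := tailP.
(* The bound 2 <= k0 makes the sum of t0 2^(-k) over k >= k0 at most t0/2. *)
have [k0 [k02 k0tail k0site k0particle]] : exists k0, [/\ (2 <= k0)%N,
    0 < tail_prob eta (N k0),
    forall k, (k0 <= k)%N -> (1 - tail_prob eta (N k)) ^+ ((2 ^ k) ^ d)%N <= 2 ^- k.+1 &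
    forall k n, (k0 <= k)%N -> (n <= d * 4 * 2 ^ k)%N ->
      (((2 ^ k) ^ d).+1 * ((2 ^ k.+1) ^ d).+1)%:R *
      (1 - reach_bound d p n) ^+ N k <= 2 ^- k.+1].
  have [k1 _ H1] := site; have [k2 _ H2] := particle.
  exists (2 + n0 + k1 + k2)%N; split.
  - by lia.
  (* Positivity of t0 comes from the tail bound itself, at a value N k0 > 1 beyond n0, where the
     logarithm is positive. *)
  - apply: lt_le_trans (n0tail _ _).
      rewrite div1r invr_gt0 powR_gt0 // ln_gt0 // ltr1n.
      by rewrite /N -(expn0 B) ltn_exp2l // expn_gt0.
    rewrite /=; apply: (@leq_trans (2 + n0 + k1 + k2)); first by lia.
    apply: leq_trans (ltnW (ltn_expl _ (ltnSn 1))) _.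
    exact: ltnW (ltn_expl _ B1).
  - by move=> k kk; apply: H1 => /=; lia.
  - by move=> k n kk; apply: H2 => /=; lia.
set t0 := tail_prob eta (N k0) in k0tail.
pose E0 := [set w | (N k0 <= sleepers FM 0%R w)%N].
have mE0 : measurable E0 by exact: measurable_leq_nat.
pose small k := E0 `&` \bigcap_(x in [set` box d k]) [set w | (sleepers FM x w < N k)%N].
pose missed k (xy : V * V) := E0 `&` \bigcap_(i < N k) ~` reach FM p xy.1 xy.2 i.
pose pairs k := [seq (x, y) | x <- 0 :: box d k, y <- 0 :: box d k.+1].
pose bad k := small k `|` \big[setU/set0]_(xy <- pairs k) missed k xy.
have msmall k : measurable (small k).
  apply: measurableI => //; apply: fin_bigcap_measurable => // x _.
  rewrite (_ : [set _ | _] = ~` [set w | (N k <= sleepers FM x w)%N]).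
    by apply: measurableC; exact: measurable_leq_nat.
  by apply/seteqP; split=> w /=; rewrite ltnNge => /negP.
have mmissed k xy : measurable (missed k xy).
  apply: measurableI => //; apply: fin_bigcap_measurable; first exact: finite_II.
  by move=> i _; apply: measurableC; exact: measurable_reach.
have mbad k : measurable (bad k).
  by apply: measurableU => //; exact: bigsetU_measurable.
have Pbad k : (k0 <= k)%N -> (P (bad k) <= (t0 * 2 ^- k)%:E)%E.
  move=> kk; apply: le_trans (probabilityU_le _ _ _) _ => //; first exact: bigsetU_measurable.
  have -> : t0 * 2 ^- k = t0 * 2 ^- k.+1 + t0 * 2 ^- k.+1 :> R.
    by rewrite exprS invfM; field.
  rewrite EFinD; apply: leeD.
    rewrite (all_small_eq FM p01) ?lee_fin ?size_box ?ler_pM2l ?k0site //.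
    by rewrite /= zero_notin_box // uniq_box.
  (* Half of the budget t0 2^(-k) went to [small k]; the other half is shared equally among the
     pairs. *)
  pose c := t0 * 2 ^- k.+1 / (((2 ^ k) ^ d).+1 * ((2 ^ k.+1) ^ d).+1)%:R.
  have -> : t0 * 2 ^- k.+1 = (size (pairs k))%:R * c.
    by rewrite /c size_allpairs /= !size_box [RHS]mulrC divfK // pnatr_eq0.
  apply: probability_bigsetU_le => // -[x y] /allpairsP[[x' y'] [/= xk yk [-> ->]]].
  apply: le_trans (no_reach_le FM p01 (N k0) (N k) x' y') _; rewrite lee_fin /c -mulrA ler_pM2l //.
  rewrite ler_pdivlMr ?ltr0n ?muln_gt0 // mulrC.
  by apply: k0particle => //; exact: l1_dist_box.
have cover : E0 `<=` root_hit_infinitely_often FM 0 p `|` \bigcup_j bad (k0 + j)%N.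
  move=> w wE0; have [wbad|wgood] := pselect ((\bigcup_j bad (k0 + j)%N) w).
    by right.
  have good k : (k0 <= k)%N -> ~ bad k w.
    by move=> kk wk; apply: wgood; exists (k - k0)%N => //; rewrite subnKC.
  left; apply: (hit_infinitely_often (N := N) wE0) => [k kk|k x y kk xk yk].
    apply: contrapT => noN; apply: (good k kk); left; split=> // x xk /=.
    by rewrite ltnNge; apply/negP => Nx; apply: noN; exists x.
  apply: contrapT => noi; apply: (good k kk); right.
  rewrite -bigcup_seq; exists (x, y); first exact: allpairs_f.
  by split=> // i iN xyi; apply: noi; exists i.
have Phalf : (P (\bigcup_j bad (k0 + j)%N) <= (t0 / 2)%:E)%E.
  apply: probability_bigcup_geometric_le => [|j|j]; first by rewrite divr_ge0 // ltW.
    exact: mbad.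
  apply: le_trans (Pbad _ (leq_addr _ _)) _; rewrite lee_fin -mulrA ler_pM2l //.
  rewrite natrX -invfM -exprS lef_pV2 ?posrE ?exprn_gt0 //.
  by apply: ler_weXn2l; [rewrite ler1n|lia].
have mhit := measurable_root_hit_infinitely_often FM 0 p.
have mbads : measurable (\bigcup_j bad (k0 + j)%N) by apply: bigcupT_measurable => j; exact: mbad.
(* If the hit event were null, [cover] would give t0 <= t0/2. *)
rewrite lt0e measure_ge0 andbT; apply/eqP => P0.
have : (t0%:E <= 0 + (t0 / 2)%:E)%E.
  rewrite -(sleepers_leq FM 0) -P0.
  apply: le_trans (leeD (lexx _) Phalf).
  apply: le_trans (probabilityU_le P mhit mbads).
  by apply: le_measure; rewrite ?inE //; exact: measurableU.
by rewrite add0e lee_fin; lra.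
Qed.

End RootHits.

(** * The critical parameter *)

Unset Implicit Arguments.

Theorem theorem1p12 (R : realType) (disp : measure_display)
  (T : measurableType disp) (P : probability T R)
  (d : nat) (hd : (1 <= d)%N)
  (eta : {RV P >-> nat})
  (eta_pos : (0 < P [set w | (1 <= eta w)%N])%E)
  (eta_tail : exists beta : R, beta < d%:R /\
     \forall n \near \oo,
       ((1 / (ln (n%:R : R) `^ beta))%:E <= P [set w | (n <= eta w)%N])%E)
  (FM : frog_model (@Zd_adj d) eta) :
  p_u FM 0 = 0.
Proof.
have [beta [betad tailP]] := eta_tail.
have tailR : \forall n \near \oo, 1 / ln (n%:R : R) `^ beta <= tail_prob eta n.
  apply: filterS tailP => n; rewrite -lee_fin /tail_prob fineK //.
  by apply: fin_num_measure; exact: measurable_leq_nat.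
rewrite /p_u; set A := [set p | _].
have Ap p : 0 < p < 1 -> A p.
  move=> p01; split; last exact: hit_probability_gt0 p01 hd _ betad tailR.
  by case/andP: p01 => /ltW -> /ltW ->.
have A_lb : lbound A 0 by move=> p [/andP[]].
have A0 : A !=set0 by exists 2^-1; apply: Ap; lra.
case: asboolP => [A_eq0|_]; first by move: A0; rewrite A_eq0 => -[].
apply/eqP; rewrite eq_le lb_le_inf // andbT leNgt; apply/negP => inf_gt0.
(* A positive infimum would leave room for some p in (0,1) below it, yet all of (0,1) lies in
   [A]. *)
have [p [p_gt0 p_lt1 p_inf]] : exists p : R, [/\ 0 < p, p < 1 & p < inf A].
  exists (Num.min 2^-1 (inf A / 2)); split.
  - by rewrite lt_min divr_gt0 // andbT invr_gt0.
  - by rewrite gt_min; apply/orP; left; lra.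
  - by rewrite gt_min; apply/orP; right; lra.
have : inf A <= p.
  by apply: ge_inf; [exists 0|apply: Ap; rewrite p_gt0].
by rewrite leNgt p_inf.
Qed.
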